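(* Let $Q_0=\mathbf 0$. For any even $K\ge2$, there exists a collection of MDPs $\{(\mathcal S,\mathcal A,\mathcal P^k,R,\gamma):k\in\{1,\dots,K\}\}$ with $|\mathcal S|=2$, $|\mathcal A|=1$, and $R=\begin{bmatrix}r_1\\ r_2\end{bmatrix}$ fixed for all MDPs in the collection, such that, for every $E\ge2$ and every time-invariant stepsize $\lambda\le\frac{1}{1+\gamma}$, synchronous federated Q-learning satisfies $$\|\Delta_T\|_\infty\ge c_R\,\frac{E}{(1-\gamma)T}$$ whenever $T/E\in\mathbb N$ and $$T\ge E\cdot\max\Big\{\exp\Big\{\frac{4E(\gamma+2)}{(1+\gamma)\gamma^2(E-1)}\Big\},\ \exp\Big\{-W_{-1}\Big(-\frac{1-\gamma}{2(1+\gamma)}\Big)\Big\}\Big\},$$ where $c_R=\frac12\min\big\{\frac{|r_1+r_2|}{e},|r_1-r_2|\big\}$ when $r_1\neq r_2$ and $c_R=\frac{|r_1+r_2|}{2e}$ otherwise.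
   Context: Setting. $\mathcal S,\mathcal A$ are finite state and action sets, $\gamma\in(0,1)$ is the discount factor, $R:\mathcal S\times\mathcal A\to[0,1]$ is the reward. There are $K$ agents; agent $k$ has the MDP $(\mathcal S,\mathcal A,\mathcal P^k,R,\gamma)$ with transition kernel $P^k(\cdot\mid s,a)$; $\mathcal S,\mathcal A,R,\gamma$ are common to all agents. The global kernel is $\bar P(s'\mid s,a)=\frac1K\sum_{k=1}^K P^k(s'\mid s,a)$. $Q^*$ is the optimal Q-function of the global MDP with kernel $\bar P$, i.e. the unique solution of $Q^*(s,a)=R(s,a)+\gamma\sum_{s'}\bar P(s'\mid s,a)\max_{a'}Q^*(s',a')$. Algorithm (synchronous federated Q-learning, synchronization period $E\ge1$, stepsize $\lambda>0$, initial $Q_0$). Set $Q_0^k=Q_0$ for all $k$. At each iteration $t=0,1,2,\dots$, every agent $k$ draws, for every $(s,a)$, a sample $s_t^k(s,a)\sim P^k(\cdot\mid s,a)$, all samples being independent across $(s,a)$, $t$ and $k$, and computes $Q^k_{t+1/2}(s,a)=(1-\lambda)Q^k_t(s,a)+\lambda\big(R(s,a)+\gamma\max_{a'}Q^k_t(s_t^k(s,a),a')\big)$. If $(t+1)\bmod E=0$, then $Q^k_{t+1}=\frac1K\sum_{j=1}^K Q^j_{t+1/2}$ for all $k$; otherwise $Q^k_{t+1}=Q^k_{t+1/2}$. Notation: $\bar Q_t=\frac1K\sum_{k=1}^K Q_t^k$, $\Delta_t=Q^*-\bar Q_t$, $\|\cdot\|_\infty$ is the maximum absolute entry. $W_{-1}$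 is the lower real branch of the Lambert $W$ function, defined on $[-1/e,0)$.
   Formalization: Proved for every given R in [0,1]² except r_1=r_2>0, where the bound fails for every choice of kernels (the error decays geometrically in T); where W_{-1} is undefined (small γ) it is given the value -1, which adds no restriction on T. *)

(* Defs.v *)
From HB Require Import structures.
From mathcomp Require Import all_boot all_order all_algebra.
From mathcomp Require Import all_classical all_reals all_analysis.
Set Implicit Arguments.
Unset Strict Implicit.
Unset Printing Implicit Defensive.
Import Order.TTheory GRing.Theory Num.Theory.
Import numFieldNormedType.Exports.
Local Open Scope classical_set_scope.
Local Open Scope ring_scope.

(* States are 'I_n and actions 'I_m.+1 (so that the maximum over actions is
   taken over a nonempty set).  Rewards and Q-functions are n x m.+1 matrices;
   the norm of 'M[R]_(n, m.+1) in MathComp-Analysis is the maximum absolute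
   entry. *)

(* [kern s a s'] is P(s' | s, a). *)
Definition transition_kernel (R : realType) (n m : nat) := 'I_n -> 'I_m -> 'I_n -> R.

Definition is_transition_kernel (R : realType) (n m : nat) (kern : transition_kernel R n m) : Prop :=
  forall s a, (forall s', 0 <= kern s a s') /\ \sum_(s' < n) kern s a s' = 1.

Definition global_kernel (R : realType) (n m K : nat)
    (kerns : 'I_K -> transition_kernel R n m) : transition_kernel R n m :=
  fun s a s' => K%:R^-1 * \sum_(k < K) kerns k s a s'.

Definition max_action (R : realType) (n m : nat) (Q : 'M[R]_(n, m.+1))
    (s : 'I_n) : R :=
  \big[Num.max/Q s ord0]_(a < m.+1) Q s a.

(* For a stochastic kernel and 0 < gamma < 1 the Bellman operator is a
   contraction, so this characterizes exactly one matrix. *)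
Definition is_optimal_Q (R : realType) (n m : nat) (kern : transition_kernel R n m.+1)
    (rew : 'M[R]_(n, m.+1)) (gamma : R) (Q : 'M[R]_(n, m.+1)) : Prop :=
  forall s a,
    Q s a = rew s a + gamma * \sum_(s' < n) kern s a s' * max_action Q s'.

Definition local_update (R : realType) (n m : nat) (rew : 'M[R]_(n, m.+1))
    (gamma lambda : R) (smp : 'I_n -> 'I_m.+1 -> 'I_n) (Q : 'M[R]_(n, m.+1)) :
    'M[R]_(n, m.+1) :=
  \matrix_(s, a) ((1 - lambda) * Q s a
                  + lambda * (rew s a + gamma * max_action Q (smp s a))).

Definition agent_mean (R : realType) (n m K : nat)
    (Q : 'I_K -> 'M[R]_(n, m)) : 'M[R]_(n, m) :=
  K%:R^-1 *: \sum_(k < K) Q k.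

(* [fedQ rew gamma lambda E Q0 smp t k] is the iterate Q_t^k along the sample
   path [smp], where [smp t k s a] is the state drawn by agent k for (s, a) at
   iteration t. *)
Fixpoint fedQ (R : realType) (n m K : nat) (rew : 'M[R]_(n, m.+1))
    (gamma lambda : R) (E : nat) (Q0 : 'M[R]_(n, m.+1))
    (smp : nat -> 'I_K -> 'I_n -> 'I_m.+1 -> 'I_n) (t : nat) :
    'I_K -> 'M[R]_(n, m.+1) :=
  match t with
  | 0%N => fun=> Q0
  | t'.+1 =>
      let Qhalf := fun k => local_update rew gamma lambda (smp t' k)
                     (fedQ rew gamma lambda E Q0 smp t' k) in
      if (E %| t'.+1)%N then fun=> agent_mean Qhalf else Qhalf
  end.

Definition mutually_independent d (T : measurableType d) (R : realType)
    (P : probability T R) (I : choiceType) (V : Type) (X : I -> T -> V) : Prop :=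
  forall (J : seq I) (B : I -> set V), uniq J ->
    P (\bigcap_(i in [set` J]) (X i @^-1` B i))
      = (\prod_(i <- J) P (X i @^-1` B i))%E.

(* The family s_t^k(s, a) of samples: discrete random variables with
   s_t^k(s, a) ~ P^k(. | s, a), independent across t, k, s and a. *)
Definition is_sampling d (T : measurableType d) (R : realType)
    (P : probability T R) (n m K : nat) (kerns : 'I_K -> transition_kernel R n m)
    (X : nat -> 'I_K -> 'I_n -> 'I_m -> T -> 'I_n) : Prop :=
  [/\ forall t k s a (B : set 'I_n), measurable (X t k s a @^-1` B),
      forall t k s a s', P (X t k s a @^-1` [set s']) = (kerns k s a s')%:E
    & mutually_independent P
        (fun i : nat * 'I_K * 'I_n * 'I_m => X i.1.1.1 i.1.1.2 i.1.2 i.2)].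

(* The lower real branch of the Lambert W function.  On [-1/e, 0) the set below
   is a singleton; elsewhere it is empty and the value is the branch-point
   value -1 = W_{-1}(-1/e). *)
Definition lambertWm1 (R : realType) (x : R) : R :=
  xget (-1) [set w : R | w <= -1 /\ w * expR w = x].

Definition reward2 (R : realType) (r1 r2 : R) : 'M[R]_(2, 1) :=
  \matrix_(s, a) (if s == ord0 then r1 else r2).

(* The branch r1 = r2 only has content as a bound when r1 = r2 = 0.  If
   r1 = r2 = r > 0 then, for any kernels and from the initial value 0, every
   iterate is constant over states and the error is exactly
   r / (1 - gamma) * (1 - lambda * (1 - gamma)) ^+ T.  For fixed lambda this
   decays geometrically in T, so it is eventually below
   c_rew r r * (E / ((1 - gamma) * T)), where c_rew r r = r / e > 0. *)
Definition c_rew (R : realType) (r1 r2 : R) : R :=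
  if r1 != r2 then
    2^-1 * Num.min (`|r1 + r2| / expR 1) `|r1 - r2|
  else `|r1 + r2| / (2 * expR 1).

Definition horizon_bound (R : realType) (gamma : R) (E : nat) : R :=
  E%:R * Num.max
    (expR ((4 * E%:R * (gamma + 2))
           / ((1 + gamma) * gamma ^+ 2 * (E%:R - 1))))
    (expR (- lambertWm1 (- ((1 - gamma) / (2 * (1 + gamma)))))).

(* Main.v *)
Require Import Defs.
From HB Require Import structures.
From mathcomp Require Import all_boot all_order all_algebra.
From mathcomp Require Import all_classical all_reals all_analysis.
From mathcomp Require Import ring lra.
Import Order.TTheory GRing.Theory Num.Theory.
Import numFieldNormedType.Exports.
Local Open Scope classical_set_scope.
Local Open Scope ring_scope.

(* Even agents stay in their state and odd agents swap the two states, all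
   deterministically, so that the run is almost surely deterministic.  The sum
   and the difference of the two Q-values evolve separately.  The error of the
   sum after T = N E steps is exactly (r1 + r2) / (1 - gamma) * a1 ^ T with
   a1 = 1 - lambda (1 - gamma), which suffices if a1 ^ T >= 1 / (e N).
   Otherwise lambda E is at least of order log N / ((1 - gamma) N).  During a
   round the difference of an identity agent contracts by a1 per step and that
   of a swap agent by a2 = 1 - lambda (1 + gamma); this heterogeneity moves the
   fixed point of the averaged difference away from r1 - r2 by a relative
   amount kappa, and (1 - gamma) kappa exceeds a multiple of 1 - a1 ^ E, hence
   of log N / N. *)

(** * Geometric sums and their dependence on the ratio *)

Definition geosum {R : pzSemiRingType} (x : R) (n : nat) : R := \sum_(i < n) x ^+ i.

Lemma geosum0 {R : pzSemiRingType} (x : R) : geosum x 0 = 0.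
Proof. exact: big_ord0. Qed.

Lemma geosumS {R : pzSemiRingType} (x : R) (n : nat) :
  geosum x n.+1 = 1 + x * geosum x n.
Proof.
rewrite /geosum big_ord_recl expr0 mulr_sumr; congr (_ + _).
by apply: eq_bigr => i _; rewrite exprS.
Qed.

Lemma geosumSr {R : pzSemiRingType} (x : R) (n : nat) :
  geosum x n.+1 = geosum x n + x ^+ n.
Proof. exact: big_ord_recr. Qed.

Lemma geosum_sub1 {R : comPzRingType} (x : R) (n : nat) :
  1 - x ^+ n = (1 - x) * geosum x n.
Proof. by rewrite -opprB subrX1 -mulNr opprB. Qed.

Section RealGeosum.
Context {R : realFieldType}.
Implicit Types x y : R.

Lemma geosum_ge0 x n : 0 <= x -> 0 <= geosum x n.
Proof. by move=> x0; apply: sumr_ge0 => i _; exact: exprn_ge0. Qed.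

Lemma geosum_gt0 x n : 0 <= x -> (0 < n)%N -> 0 < geosum x n.
Proof.
case: n => // n x0 _; rewrite geosumS.
by rewrite ltr_wpDr // mulr_ge0 // geosum_ge0.
Qed.

Lemma ler_geosum x y n : 0 <= x -> x <= y -> geosum x n <= geosum y n.
Proof. by move=> x0 xy; apply: ler_sum => i _; rewrite lerXn2r // nnegrE (le_trans x0). Qed.

Lemma geosum_ge_last x n : 0 <= x <= 1 -> n%:R * x ^+ n <= geosum x n.
Proof.
move=> /andP[x0 x1]; rewrite mulr_natl -[n in _ *+ n]card_ord -sumr_const.
by apply: ler_sum => i _; rewrite ler_wiXn2l // ltnW.
Qed.

(** The powers of [x] decrease, so averaging over a longer prefix can only lower the mean. *)
Lemma geosum_avg x k n : 0 <= x <= 1 -> (k <= n)%N ->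
  k%:R * geosum x n <= n%:R * geosum x k.
Proof.
move=> x01; have /andP[x0 x1] := x01; elim: n => [|n IHn].
  by rewrite leqn0 => /eqP ->.
rewrite leq_eqVlt => /predU1P[->//|]; rewrite ltnS => kn.
have le_last : k%:R * x ^+ n <= geosum x k.
  apply: le_trans (geosum_ge_last x k x01).
  by rewrite ler_wpM2l // ler_wiXn2l.
have := IHn kn; rewrite geosumSr -natr1; lra.
Qed.

(** [geosum x k] is concave in [k], hence lies above its chord from 0 to [n]; summing the chord over
    [k < n] gives the factor [(n - 1) / 2]. *)
Lemma sum_geosum_ge x n : 0 <= x <= 1 ->
  (n%:R - 1) * geosum x n <= 2 * \sum_(k < n) geosum x k.
Proof.
move=> x01; elim: n => [|n IHn]; first by rewrite geosum0 big_ord0 !mulr0.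
rewrite big_ord_recr /= geosumSr -natr1.
have := geosum_ge_last x n x01; lra.
Qed.

(* With [c] the average of the powers of [y] below [m], this is a discrete form
   of the lower bound for the derivative of [geosum]. *)
Lemma geosum_diff_ge_sum x y c m n : 0 <= x <= 1 -> 0 <= y <= x -> (n <= m)%N ->
  m%:R * c = geosum y m -> (0 < m)%N ->
  (x - y) * (c * \sum_(k < n) geosum x k) <= geosum x n - geosum y n.
Proof.
move=> /andP[x0 x1] /andP[y0 yx] nm cE m0.
have sumE k : \sum_(i < k.+1) geosum x i = x * \sum_(i < k) geosum x i + k%:R.
  rewrite big_ord_recl geosum0 add0r mulr_sumr -[k in k%:R]card_ord.
  rewrite -sumr_const -big_split; apply: eq_bigr => i _ /=.
  by rewrite /bump /= add1n geosumS addrC.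
elim: n nm => [|n IHn] nm; first by rewrite big_ord0 !geosum0 !mulr0 subrr.
(* A prefix shorter than [m] has the larger average, so the same [c] serves at every stage of the
   induction. *)
have avg : n%:R * c <= geosum y n.
  have := @geosum_avg y n m _ (ltnW nm).
  rewrite -cE mulrCA ler_pM2l ?ltr0n //; apply.
  by rewrite y0 (le_trans yx).
rewrite sumE !geosumS.
have -> : (x - y) * (c * (x * (\sum_(i < n) geosum x i) + n%:R)) =
  x * ((x - y) * (c * \sum_(i < n) geosum x i)) + (x - y) * (n%:R * c) by ring.
have -> : 1 + x * geosum x n - (1 + y * geosum y n) =
  x * (geosum x n - geosum y n) + (x - y) * geosum y n by ring.
by rewrite lerD // ler_wpM2l ?subr_ge0 // IHn // ltnW.
Qed.

Lemma geosum_diff_ge x y n : 0 <= x <= 1 -> 0 <= y <= x -> (0 < n)%N ->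
  (x - y) * (n%:R - 1) * (geosum x n * geosum y n) <=
    2 * n%:R * (geosum x n - geosum y n).
Proof.
move=> x01 yx n0; have /andP[y0 yx'] := yx.
have nR0 : 0 < n%:R :> R by rewrite ltr0n.
pose c := geosum y n / n%:R.
have cE : n%:R * c = geosum y n by rewrite /c mulrC divfK // gt_eqF.
have := @geosum_diff_ge_sum x y c n n x01 yx (leqnn n) cE n0.
rewrite -(ler_pM2l (_ : 0 < 2 * n%:R)) ?mulr_gt0 //; apply: le_trans.
have -> : 2 * n%:R * ((x - y) * (c * (\sum_(k < n) geosum x k))) =
  (x - y) * geosum y n * (2 * \sum_(k < n) geosum x k) by rewrite -cE; ring.
have -> : (x - y) * (n%:R - 1) * (geosum x n * geosum y n) =
  (x - y) * geosum y n * ((n%:R - 1) * geosum x n) by ring.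
by rewrite ler_wpM2l ?sum_geosum_ge // mulr_ge0 ?subr_ge0 ?geosum_ge0.
Qed.

End RealGeosum.

(** * Exponential estimates and the drift bound *)

Lemma expR1_ge {R : realType} : 12 / 5 <= expR 1 :> R.
Proof.
have -> : 1 = 4%:R * 4^-1 :> R by rewrite divff.
rewrite expRM_natl.
(* The fourth power of 5/4 is 625/256, which exceeds 12/5. *)
have q : (1 + 4^-1) ^+ 4 <= expR 4^-1 ^+ 4 :> R.
  by rewrite lerXn2r ?expR_ge1Dx // nnegrE ?expR_ge0.
apply: le_trans q; lra.
Qed.

(** At [L = 6] the left side is 140, below [(12/5) ^ 6]; beyond 6, the tangent bound on
    [expR (L - 6)] outgrows the affine side. *)
Lemma expR_ge_affine {R : realType} (L : R) : 6 <= L -> 20 * (1 + L) <= expR L.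
Proof.
move=> L6; rewrite -[L in expR L](subrK 6) expRD.
have e6 : 140 <= expR 6 :> R.
  have -> : 6 = 6%:R * 1 :> R by rewrite mulr1.
  rewrite expRM_natl.
  have : (12 / 5) ^+ 6 <= expR 1 ^+ 6 :> R.
    by rewrite lerXn2r ?expR1_ge // nnegrE ?expR_ge0.
  apply: le_trans; lra.
have := expR_ge1Dx (L - 6) => le1.
have : (1 + (L - 6)) * 140 <= expR (L - 6) * expR 6.
  by apply: ler_pM => //; lra.
lra.
Qed.

(** By contraposition: if [x * N] is smaller, then [x < 1/20], and [1 - x >= exp (- x / (1 - x)) >=
    exp (- (1 + L) / N)], whose [N]-th power is [1 / (e N)]. The factor 19/20 absorbs the division
    by [1 - x]. *)
Lemma small_power_ge {R : realType} (x L : R) (N : nat) :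
  6 <= L -> N%:R = expR L -> x <= 1 ->
  (1 - x) ^+ N < (expR 1 * N%:R)^-1 -> 19 / 20 * (1 + L) <= x * N%:R.
Proof.
move=> L6 NE x1; apply: contraTT; rewrite -ltNge -leNgt => xN.
have N20 := expR_ge_affine L L6.
have N0 : 0 < N%:R :> R by rewrite NE expR_gt0.
have x20 : x < 20^-1.
  rewrite -(ltr_pM2r N0) (lt_le_trans xN) // NE; lra.
have x1' : 0 < 1 - x by lra.
rewrite NE -expRD -expRN.
have -> : - (1 + L) = N%:R * (- (1 + L) / N%:R).
  by rewrite mulrC divfK // gt_eqF.
rewrite expRM_natl lerXn2r ?nnegrE ?expR_ge0 ?(ltW x1') //.
have le_inv : 1 + x / (1 - x) <= expR (x / (1 - x)) := expR_ge1Dx _.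
have E1 : 1 + x / (1 - x) = (1 - x)^-1 by field; rewrite gt_eqF.
rewrite -[leRHS]invrK -E1 mulNr expRN lef_pV2 ?posrE ?expR_gt0 //; last first.
  by rewrite E1 invr_gt0.
apply: le_trans le_inv _; rewrite ler_expR.
rewrite ler_pdivrMr // mulrAC ler_pdivlMr //.
have : (1 + L) * (19 / 20) <= (1 + L) * (1 - x) by rewrite ler_wpM2l //; lra.
lra.
Qed.

(* [kappa] is the relative error of the fixed point of one round of the
   averaged difference of the two states, and [a1], [a2] are the factors by
   which an identity agent and a swap agent contract that difference. *)
Lemma drift_ge {R : realType} (gamma lambda : R) (E N : nat) :
  let a1 := 1 - lambda * (1 - gamma) in
  let a2 := 1 - lambda * (1 + gamma) in
  let S1 := geosum a1 E in let S2 := geosum a2 E in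
  let kappa := gamma * (S1 - S2) / ((1 - gamma) * S1 + (1 + gamma) * S2) in
  0 < gamma -> gamma < 1 -> 0 < lambda -> lambda * (1 + gamma) <= 1 ->
  (2 <= E)%N ->
  expR ((4 * E%:R * (gamma + 2)) / ((1 + gamma) * gamma ^+ 2 * (E%:R - 1)))
    <= N%:R ->
  (a1 ^+ E) ^+ N < (expR 1 * N%:R)^-1 ->
  ((1 - gamma) * N%:R)^-1 <=
    kappa - (1 + kappa) * ((a1 ^+ E + a2 ^+ E) / 2) ^+ N.
Proof.
move=> a1 a2 S1 S2 kappa g0 g1 l0 lg E2 hN a1N.
have E0 : (0 < E)%N by exact: leq_trans E2.
have ER2 : 2 <= E%:R :> R by rewrite (ler_nat R 2 E).
have N0 : 0 < N%:R :> R by exact: lt_le_trans (expR_gt0 _) hN.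
have lg0 : 0 < lambda * gamma by exact: mulr_gt0.
have a20 : 0 <= a2 by rewrite /a2; lra.
have a21 : a2 <= a1 by rewrite /a1 /a2; lra.
have a10 : 0 <= a1 by exact: le_trans a21.
have a11 : a1 <= 1.
  by rewrite /a1 gerBl mulr_ge0 // ?ltW // subr_gt0.
have S10 : 0 < S1 by exact: geosum_gt0.
have S20 : 0 < S2 by exact: geosum_gt0.
have S21 : S2 <= S1 by exact: ler_geosum.
pose D := (1 - gamma) * S1 + (1 + gamma) * S2.
have D0 : 0 < D by rewrite addr_gt0 // mulr_gt0 //; lra.
have kappaE : kappa * D = gamma * (S1 - S2) by rewrite divfK // gt_eqF.
have kappa0 : 0 <= kappa.
  by rewrite divr_ge0 ?(ltW D0) // mulr_ge0 ?subr_ge0 // ltW.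
(* Here [(1 + kappa) * D = S1 + S2], and [D >= (1 - gamma) * (S1 + S2)]. *)
have kappa1 : 1 + kappa <= (1 - gamma)^-1.
  rewrite -[leRHS]mul1r ler_pdivlMr ?subr_gt0 //.
  rewrite -(ler_pM2r D0) mulrAC mulrDl kappaE mul1r /D.
  have : 0 <= gamma * S2 by rewrite mulr_ge0 // ltW.
  nra.
have xE : 1 - a1 ^+ E = lambda * (1 - gamma) * S1.
  by rewrite geosum_sub1 /S1 /a1; congr (_ * _); ring.
have yE : 1 - a2 ^+ E = lambda * (1 + gamma) * S2.
  by rewrite geosum_sub1 /S2 /a2; congr (_ * _); ring.
have a2a1E : a2 ^+ E <= a1 ^+ E by rewrite lerXn2r.
(* As [1 - a1 ^+ E <= 1 - a2 ^+ E], the first summand of [D] is at most the second. *)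
have D2 : D <= 2 * (1 + gamma) * S2.
  have : lambda * ((1 - gamma) * S1) <= lambda * ((1 + gamma) * S2) by lra.
  rewrite ler_pM2l // /D; lra.
pose x := 1 - a1 ^+ E.
pose L := ln N%:R : R.
have NE : N%:R = expR L by rewrite lnK.
set l := (X in expR X) in hN.
have lL : l <= L by rewrite -ler_expR -NE.
have den0 : 0 < (1 + gamma) * gamma ^+ 2 * (E%:R - 1).
  by rewrite !mulr_gt0 ?exprn_gt0 //; lra.
have lE : l * ((1 + gamma) * gamma ^+ 2 * (E%:R - 1)) = 4 * E%:R * (gamma + 2).
  by rewrite divfK // gt_eqF.
(* The factor [4 (gamma + 2) / ((1 + gamma) gamma^2)] decreases to 6 as [gamma] tends to 1, and
   [E / (E - 1) > 1]. *)
have l6 : 6 <= l.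
  rewrite ler_pdivlMr //.
  have g2 : (1 + gamma) * gamma ^+ 2 <= 2.
    have := exprn_ile1 2 (ltW g0) (ltW g1); have := exprn_ile1 3 (ltW g0) (ltW g1); lra.
  have : (1 + gamma) * gamma ^+ 2 * (E%:R - 1) <= 2 * E%:R.
    by apply: ler_pM; rewrite ?mulr_ge0 ?exprn_ge0 //; lra.
  nra.
have xN : 19 / 20 * (1 + L) <= x * N%:R.
  apply: small_power_ge => //; first exact: le_trans lL.
    by rewrite gerBl exprn_ge0.
  by rewrite opprB addrC subrK.
have dS : lambda * gamma * (E%:R - 1) * (S1 * S2) <= E%:R * (S1 - S2).
  have := @geosum_diff_ge R a1 a2 E; rewrite a10 a11 a20 a21.
  move=> /(_ isT isT E0).
  have -> : a1 - a2 = 2 * (lambda * gamma) by rewrite /a1 /a2; ring.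
  rewrite -/S1 -/S2; lra.
(* After multiplication by [S2] the left side contains the product bounded in [dS]; [S1 - S2] then
   becomes a multiple of [kappa * D], and [D2] cancels [S2] again. *)
have kx : gamma ^+ 2 * (E%:R - 1) * x <=
    kappa * (1 - gamma) * (2 * E%:R * (1 + gamma)).
  rewrite -(ler_pM2r S20).
  have -> : gamma ^+ 2 * (E%:R - 1) * x * S2 =
     gamma * (1 - gamma) * (lambda * gamma * (E%:R - 1) * (S1 * S2)).
    by rewrite /x xE; ring.
  have gg : 0 <= gamma * (1 - gamma) by rewrite mulr_ge0 //; lra.
  apply: le_trans (ler_wpM2l gg dS) _.
  have -> : gamma * (1 - gamma) * (E%:R * (S1 - S2)) =
    (1 - gamma) * E%:R * kappa * D by rewrite -[RHS]mulrA kappaE; ring.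
  have -> : kappa * (1 - gamma) * (2 * E%:R * (1 + gamma)) * S2 =
    (1 - gamma) * E%:R * kappa * (2 * (1 + gamma) * S2) by ring.
  apply: ler_wpM2l D2; apply: mulr_ge0 kappa0; apply: mulr_ge0 => //; lra.
(* Combining [kx], [xN] and [l <= L] gives [19/20 * 2 (gamma + 2) / (1 + gamma)^2]; the last
   fraction is at least 3/2, its value at [gamma = 1], whence 57/40. *)
have kN : 57 / 40 <= kappa * (1 - gamma) * N%:R.
  have EG0 : 0 < 2 * E%:R * (1 + gamma) by rewrite !mulr_gt0 //; lra.
  rewrite -(ler_pM2r EG0).
  have gE0 : 0 <= gamma ^+ 2 * (E%:R - 1) by rewrite mulr_ge0 ?sqr_ge0 //; lra.
  have h1 : gamma ^+ 2 * (E%:R - 1) * x * N%:R <=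
     kappa * (1 - gamma) * (2 * E%:R * (1 + gamma)) * N%:R by rewrite ler_wpM2r // ltW.
  have h2 : gamma ^+ 2 * (E%:R - 1) * (19 / 20 * l) <=
     gamma ^+ 2 * (E%:R - 1) * (x * N%:R).
    by rewrite ler_wpM2l //; lra.
  have h3 : 57 / 40 * (2 * E%:R * (1 + gamma)) <=
     gamma ^+ 2 * (E%:R - 1) * (19 / 20 * l).
    have g10 : 0 < 1 + gamma by lra.
    rewrite -(ler_pM2l g10).
    have -> : (1 + gamma) * (gamma ^+ 2 * (E%:R - 1) * (19 / 20 * l)) =
      19 / 20 * (l * ((1 + gamma) * gamma ^+ 2 * (E%:R - 1))) by ring.
    rewrite lE.
    have -> : (1 + gamma) * (57 / 40 * (2 * E%:R * (1 + gamma))) =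
       E%:R * (57 / 20 * (1 + gamma) ^+ 2) by field.
    have -> : 19 / 20 * (4 * E%:R * (gamma + 2)) =
       E%:R * (19 / 5 * (gamma + 2)) by field.
    by rewrite ler_wpM2l //; have := exprn_ile1 2 (ltW g0) (ltW g1); lra.
  lra.
have aN : ((a1 ^+ E + a2 ^+ E) / 2) ^+ N <= (expR 1 * N%:R)^-1.
  apply: le_trans (ltW a1N).
  have p1 : 0 <= a1 ^+ E by exact: exprn_ge0.
  have p2 : 0 <= a2 ^+ E by exact: exprn_ge0.
  by rewrite lerXn2r ?nnegrE //; lra.
have kaN : (1 + kappa) * ((a1 ^+ E + a2 ^+ E) / 2) ^+ N <=
    (1 - gamma)^-1 * (expR 1 * N%:R)^-1.
  by rewrite ler_pM // ?exprn_ge0 // ?divr_ge0 ?addr_ge0 ?exprn_ge0.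
have e1 : (expR 1)^-1 <= 5 / 12 :> R.
  have -> : 5 / 12 = (12 / 5)^-1 :> R by field.
  by rewrite lef_pV2 ?expR1_ge // posrE ?expR_gt0 // divr_gt0.
have kN' : 57 / 40 * ((1 - gamma) * N%:R)^-1 <= kappa.
  rewrite ler_pdivrMr ?mulr_gt0 ?subr_gt0 //; lra.
(* The margin is [57/40 - 5/12 = 121/120], just above 1. *)
have : (1 - gamma)^-1 * (expR 1 * N%:R)^-1 <= 5 / 12 * ((1 - gamma) * N%:R)^-1.
  rewrite !invfM mulrCA ler_wpM2r // ?mulr_ge0 // invr_ge0; lra.
have : 0 <= ((1 - gamma) * N%:R)^-1.
  by rewrite invr_ge0 mulr_ge0 //; lra.
lra.
Qed.

(** * The two-state run *)

Section Witness.
Context {R : realType}.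
Implicit Types (Q : 'M[R]_(2, 1)) (gamma lambda : R).

Definition swap_if (b : bool) (s : 'I_2) : 'I_2 := if b then rev_ord s else s.

Definition swap_kernel (b : bool) : transition_kernel R 2 1 :=
  fun s _ s' => (s' == swap_if b s)%:R.

Definition state_sum Q : R := Q ord0 ord0 + Q ord_max ord0.

Definition state_diff Q : R := Q ord0 ord0 - Q ord_max ord0.

Lemma swap_kernelP b : is_transition_kernel (swap_kernel b).
Proof.
move=> s a; split=> [s'|]; first exact: ler0n.
rewrite (bigD1 (swap_if b s)) //= big1 ?addr0 /swap_kernel ?eqxx // => s' /negbTE ->.
by [].
Qed.

Lemma avg_parity K (f : bool -> R) : ~~ odd K -> (0 < K)%N ->
  K%:R^-1 * \sum_(k < K) f (odd k) = (f false + f true) / 2.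
Proof.
move=> evK K0; rewrite -(even_halfK evK) -muln2.
have h0 : K./2%:R != 0 :> R.
  by rewrite pnatr_eq0 -lt0n half_gt0; case: K evK K0 => [|[]].
have -> : \sum_(k < K./2 * 2) f (odd k) = (f false + f true) *+ K./2.
  elim: K./2 => [|m IHm]; first by rewrite big_ord0 mulr0n.
  rewrite mulSn addnC addn2 !big_ord_recr /= IHm oddM andbF /= -addrA.
  by rewrite mulrS addrC.
by rewrite -[_ *+ K./2]mulr_natr natrM; field.
Qed.

Lemma max_action1 Q s : max_action Q s = Q s ord0.
Proof. by rewrite /max_action big_ord_recl big_ord0 maxxx. Qed.

(** The sum is symmetric in the two states, so staying and swapping act on it alike. *)
Lemma local_update_sum r1 r2 gamma lambda b Q :
  state_sum (local_update (reward2 r1 r2) gamma lambda (fun s _ => swap_if b s) Q)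
    = (1 - lambda * (1 - gamma)) * state_sum Q + lambda * (r1 + r2).
Proof.
rewrite /state_sum !mxE !max_action1 /=.
have rev0 : rev_ord ord0 = ord_max :> 'I_2 by exact: val_inj.
have rev1 : rev_ord ord_max = ord0 :> 'I_2 by exact: val_inj.
by rewrite /swap_if; case: b; rewrite ?rev0 ?rev1; ring.
Qed.

(** Swapping reverses the sign of the difference in the discounted term, so the two kinds of agents
    contract at different rates. *)
Lemma local_update_diff r1 r2 gamma lambda b Q :
  state_diff (local_update (reward2 r1 r2) gamma lambda (fun s _ => swap_if b s) Q)
    = (1 - lambda * (1 + (-1) ^+ (~~ b) * gamma)) * state_diff Q + lambda * (r1 - r2).
Proof.
rewrite /state_diff !mxE !max_action1 /=.
have rev0 : rev_ord ord0 = ord_max :> 'I_2 by exact: val_inj.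
have rev1 : rev_ord ord_max = ord0 :> 'I_2 by exact: val_inj.
by rewrite /swap_if; case: b; rewrite /= ?rev0 ?rev1 ?expr1 ?expr0; ring.
Qed.

Lemma agent_mean_sum K (Q : 'I_K -> 'M[R]_(2, 1)) :
  state_sum (agent_mean Q) = K%:R^-1 * \sum_(k < K) state_sum (Q k).
Proof.
by rewrite /state_sum /agent_mean !mxE !summxE -mulrDr big_split.
Qed.

Lemma agent_mean_diff K (Q : 'I_K -> 'M[R]_(2, 1)) :
  state_diff (agent_mean Q) = K%:R^-1 * \sum_(k < K) state_diff (Q k).
Proof.
by rewrite /state_diff /agent_mean !mxE !summxE -mulrBr sumrB.
Qed.

Lemma agent_mean_const K Q : (0 < K)%N -> agent_mean (fun _ : 'I_K => Q) = Q.
Proof.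
move=> K0; rewrite /agent_mean sumr_const card_ord -[Q *+ K]scaler_nat scalerA.
by rewrite mulVf ?scale1r // pnatr_eq0 -lt0n.
Qed.

Section Run.
Context (r1 r2 gamma lambda : R) (E K : nat).
Context (E_gt0 : (0 < E)%N) (K_gt0 : (0 < K)%N) (K_even : ~~ odd K).

Let a1 := 1 - lambda * (1 - gamma).
Let a2 := 1 - lambda * (1 + gamma).

Let run : nat -> 'I_K -> 'M[R]_(2, 1) :=
  fedQ (reward2 r1 r2) gamma lambda E 0 (fun _ k s _ => swap_if (odd k) s).

(** All agents share the same sum at every time, so averaging never changes it. *)
Lemma run_sum t k : gamma != 1 ->
  state_sum (run t k) = (r1 + r2) / (1 - gamma) * (1 - a1 ^+ t).
Proof.
move=> g1; have g1' : 1 - gamma != 0 by rewrite subr_eq0 eq_sym.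
elim: t k => [|t IHt] k.
  by rewrite /run /state_sum /= !mxE expr0; ring.
have half (j : 'I_K) : state_sum (local_update (reward2 r1 r2) gamma lambda
    (fun s _ => swap_if (odd j) s) (run t j)) =
    (r1 + r2) / (1 - gamma) * (1 - a1 ^+ t.+1).
  by rewrite local_update_sum IHt exprS /a1; field.
rewrite /run /=; case: ifP => _; last exact: half.
rewrite agent_mean_sum (eq_bigr _ (fun j _ => half j)) sumr_const card_ord.
by rewrite mulrnAr -mulrnAl -(mulr_natl K%:R^-1) divff ?mul1r // pnatr_eq0 -lt0n.
Qed.

(** At time 0 and right after averaging all agents agree, so the mean can be read off from any
    single agent. *)
Lemma run_sync m k : run (m * E)%N k = agent_mean (run (m * E)%N).
Proof.
suff [Q runE] : exists Q, run (m * E)%N = fun=> Q by rewrite runE agent_mean_const.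
have [|mE0] := posnP (m * E)%N; first by move=> ->; exists 0.
rewrite -(prednK mE0) /run /= (prednK mE0) dvdn_mull //.
by eexists.
Qed.

Lemma run_diff_local m w i (k : 'I_K) : (i < E)%N ->
  (forall j, state_diff (run (m * E)%N j) = w) ->
  let a := if odd k then a2 else a1 in
  state_diff (run (m * E + i)%N k) = a ^+ i * w + lambda * (r1 - r2) * geosum a i.
Proof.
move=> iE w0 a; elim: i iE => [|i IHi] iE.
  by rewrite addn0 w0 geosum0 expr0 mul1r mulr0 addr0.
(* No averaging happens strictly inside a round, because [0 < i + 1 < E]. *)
rewrite /run addnS /= -addnS dvdn_addr ?dvdn_mull // gtnNdvd //.
rewrite local_update_diff (IHi (ltnW iE)) geosumS exprS.
have -> : 1 - lambda * (1 + (-1) ^+ (~~ odd k) * gamma) = a.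
  by rewrite /a; case: (odd k); rewrite /= ?expr0 ?expr1 /a1 /a2; ring.
ring.
Qed.

Lemma run_diff_round m w : (forall j, state_diff (run (m * E)%N j) = w) ->
  forall k, state_diff (run (m.+1 * E)%N k) = (a1 ^+ E + a2 ^+ E) / 2 * w +
    lambda * (r1 - r2) * ((geosum a1 E + geosum a2 E) / 2).
Proof.
move=> w0 k.
have mE : (m.+1 * E = (m * E + E.-1).+1)%N by rewrite mulSn addnC -addnS prednK.
have dvdE : (E %| (m * E + E.-1).+1)%N by rewrite -mE dvdn_mull.
rewrite mE /run /= dvdE agent_mean_diff.
(* The difference after all [E] local steps, just before averaging, depends only on the parity of
   the agent. *)
pose f b := (if b then a2 else a1) ^+ E * w +
  lambda * (r1 - r2) * geosum (if b then a2 else a1) E.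
rewrite (eq_bigr (fun j : 'I_K => f (odd j))) => [|j _].
  by rewrite avg_parity // /f; field.
rewrite local_update_diff (run_diff_local _ _ _ _ _ w0) ?prednK // /f.
rewrite -[in RHS](prednK E_gt0) geosumS exprS.
have -> : 1 - lambda * (1 + (-1) ^+ (~~ odd j) * gamma) = if odd j then a2 else a1.
  by case: (odd j); rewrite /= ?expr0 ?expr1 /a1 /a2; ring.
ring.
Qed.

(** The hypothesis makes [(r1 - r2) * (1 + kappa)] a fixed point of the affine map of one round,
    which is iterated from 0. *)
Lemma run_diff m k kappa :
  (1 + kappa) * (1 - (a1 ^+ E + a2 ^+ E) / 2) =
    lambda * ((geosum a1 E + geosum a2 E) / 2) ->
  state_diff (run (m * E)%N k) =
    (r1 - r2) * (1 + kappa) * (1 - ((a1 ^+ E + a2 ^+ E) / 2) ^+ m).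
Proof.
move=> kE; elim: m k => [|m IHm] k.
  by rewrite mul0n /run /state_diff /= !mxE expr0 !subrr mulr0.
rewrite (run_diff_round _ _ IHm) exprS [lambda * (r1 - r2)]mulrC -[_ * lambda * _]mulrA -kE.
ring.
Qed.

End Run.
End Witness.

(** * The optimal Q-function, norm bounds and the almost sure sample path *)

Lemma optimal_Q_sum_diff {R : realType} (gamma r1 r2 : R) K (Q : 'M[R]_(2, 1)) :
  gamma != 1 -> ~~ odd K -> (0 < K)%N ->
  is_optimal_Q (global_kernel (fun k : 'I_K => swap_kernel (odd k)))
    (reward2 r1 r2) gamma Q ->
  state_sum Q = (r1 + r2) / (1 - gamma) /\ state_diff Q = r1 - r2.
Proof.
move=> g1 evK K0 optQ.
(* Half of the agents stay and half swap, so the global kernel is uniform and both states have the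
   same expected future value. *)
have gk s a s' : global_kernel (fun k : 'I_K => swap_kernel (odd k)) s a s' = 2^-1 :> R.
  rewrite /global_kernel (avg_parity _ (fun b => swap_kernel b s a s')) //.
  rewrite /swap_kernel /swap_if.
  suff -> : (s' == s)%:R + (s' == rev_ord s)%:R = 1 :> R by rewrite mul1r.
  by case: s => [[|[|]]] //= ?; case: s' => [[|[|]]] //= ?; rewrite ?addr0 ?add0r.
have optE s : Q s ord0 = reward2 r1 r2 s ord0 + gamma * (2^-1 * state_sum Q).
  rewrite {1}optQ; congr (_ + _ * _).
  under eq_bigr do rewrite gk max_action1.
  rewrite -mulr_sumr big_ord_recl big_ord1; congr (_ * (_ + Q _ _)).
  exact: val_inj.
have g1' : 1 - gamma != 0 by rewrite subr_eq0 eq_sym.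
have := optE ord0; have := optE ord_max; rewrite !mxE /= /state_diff => e1 e0.
split; last by rewrite e0 e1; ring.
apply: (mulIf g1'); rewrite divfK // mulrBr mulr1 {1}/state_sum e0 e1.
by field.
Qed.

Lemma le_mx_norm {R : realDomainType} m n (A : 'M[R]_(m, n)) i j : `|A i j| <= mx_norm A.
Proof.
rewrite mx_normrE; exact: (le_bigmax _ (fun ij => `|A ij.1 ij.2|) (i, j)).
Qed.

Lemma state_sum_norm {R : realType} (A : 'M[R]_(2, 1)) : `|state_sum A| <= 2 * `|A|.
Proof.
by rewrite mulr_natl mulr2n (le_trans (ler_normD _ _)) // lerD // le_mx_norm.
Qed.

Lemma state_diff_norm {R : realType} (A : 'M[R]_(2, 1)) : `|state_diff A| <= 2 * `|A|.
Proof.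
by rewrite mulr_natl mulr2n (le_trans (ler_normB _ _)) // lerD // le_mx_norm.
Qed.

Lemma ae_eq_mass1 d (T : measurableType d) {R : realType} (P : probability T R)
    (A : set T) : measurable A -> P A = 1%E -> {ae P, forall w, A w}.
Proof.
move=> mA PA; exists (~` A); split => //; first exact: measurableC.
by rewrite probability_setC // PA subee.
Qed.

(** Each sample is a point mass, and there are only countably many of them, so all take their
    prescribed values simultaneously. *)
Lemma sampling_ae_eq d (T : measurableType d) {R : realType} (P : probability T R)
    K (X : nat -> 'I_K -> 'I_2 -> 'I_1 -> T -> 'I_2) :
  is_sampling P (fun k => swap_kernel (odd k)) X ->
  {ae P, forall w, (fun t k s a => X t k s a w) = (fun _ k s _ => swap_if (odd k) s)}.
Proof.
case=> mX PX _.
have : {ae P, forall w, forall t k s a, X t k s a w = swap_if (odd k) s}.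
  apply: ae_foralln => t; do 3 apply: filter_forall => ?.
  apply: (ae_eq_mass1 _ _ _ _ (mX _ _ _ _ [set swap_if _ _])).
  by rewrite PX /swap_kernel eqxx.
apply: filterS => w Xw.
by do 4 apply: funext => ?.
Qed.

(** * Assembly of the lower bound *)

Theorem theorem2 (R : realType) (gamma : R) (K : nat) (r1 r2 : R)
  (gamma_gt0 : 0 < gamma) (gamma_lt1 : gamma < 1)
  (K_ge2 : (2 <= K)%N) (K_even : ~~ odd K)
  (r1_01 : 0 <= r1 <= 1) (r2_01 : 0 <= r2 <= 1)
  (r12 : r1 <> r2 \/ (r1 = 0 /\ r2 = 0)) :
  exists kerns : 'I_K -> transition_kernel R 2 1,
    (forall k, is_transition_kernel (kerns k)) /\
    forall (E : nat) (lambda : R) (T : nat),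
      (2 <= E)%N -> 0 < lambda -> lambda <= (1 + gamma)^-1 ->
      (E %| T)%N -> horizon_bound gamma E <= T%:R ->
    forall (d : measure_display) (Omega : measurableType d)
      (P : probability Omega R)
      (X : nat -> 'I_K -> 'I_2 -> 'I_1 -> Omega -> 'I_2)
      (Qstar : 'M[R]_(2, 1)),
      is_sampling P kerns X ->
      is_optimal_Q (global_kernel kerns) (reward2 r1 r2) gamma Qstar ->
      {ae P, forall w,
        c_rew r1 r2 * (E%:R / ((1 - gamma) * T%:R)) <=
        `| Qstar - agent_mean (fedQ (reward2 r1 r2) gamma lambda E 0
                                 (fun t k s a => X t k s a w) T) | }.
Proof.
exists (fun k => swap_kernel (odd k)); split => [k|]; first exact: swap_kernelP.
move=> E lambda T E2 l0 lg /dvdnP[N ->] hT d Omega P X Qstar sX optQ.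
apply: filterS (sampling_ae_eq _ _ _ _ _ sX) => w /= ->.
have K0 : (0 < K)%N by exact: leq_trans K_ge2.
have E0 : (0 < E)%N by exact: leq_trans E2.
have ER0 : 0 < E%:R :> R by rewrite ltr0n.
have g1 : gamma != 1 by rewrite lt_eqF.
have g1' : 0 < 1 - gamma by rewrite subr_gt0.
have lg' : lambda * (1 + gamma) <= 1.
  by rewrite -ler_pdivlMr ?div1r // ltr_wpDr // ltW.
have [qs qd] := optimal_Q_sum_diff _ _ _ _ _ g1 K_even K0 optQ.
set smp := fun _ k s _ => _.
pose k0 := Ordinal K0.
rewrite -(run_sync _ _ _ _ _ _ K0 N k0).
set QT := fedQ _ _ _ _ _ _ _ _.
have {hT} hN : expR ((4 * E%:R * (gamma + 2))
    / ((1 + gamma) * gamma ^+ 2 * (E%:R - 1))) <= N%:R.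
  move: hT; rewrite /horizon_bound natrM mulrC ler_pM2r // ge_max.
  by case/andP.
have N0 : 0 < N%:R :> R by exact: lt_le_trans (expR_gt0 _) hN.
have -> : E%:R / ((1 - gamma) * (N * E)%:R) = ((1 - gamma) * N%:R)^-1.
  by rewrite natrM; field; rewrite !gt_eqF.
set B := ((1 - gamma) * N%:R)^-1.
have B0 : 0 <= B by rewrite invr_ge0 mulr_ge0 // ltW.
(* Zero rewards make [c_rew] vanish; otherwise [r12] leaves [r1 != r2]. *)
have [r0|] := boolP ((r1 == 0) && (r2 == 0)).
  case/andP: r0 => /eqP-> /eqP->.
  by rewrite /c_rew eqxx addr0 normr0 !mul0r.
move=> r0.
have rne : r1 != r2.
  by apply/eqP => re; case: r12 => // -[r10 r20]; rewrite r10 r20 eqxx in r0.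
rewrite /c_rew rne -mulrA ler_pdivrMl //.
have sumD A C : state_sum (A - C) = state_sum A - state_sum C :> R.
  by rewrite /state_sum !mxE; ring.
have diffD A C : state_diff (A - C) = state_diff A - state_diff C :> R.
  by rewrite /state_diff !mxE; ring.
pose a1 := 1 - lambda * (1 - gamma); pose a2 := 1 - lambda * (1 + gamma).
(* The sum yields the entry [|r1 + r2| / e] of the minimum in the first case, the difference yields
   [|r1 - r2|] in the second. *)
have [a1N|a1N] := leP (expR 1 * N%:R)^-1 ((a1 ^+ E) ^+ N).
  apply: le_trans (state_sum_norm _).
  rewrite sumD qs run_sum //.
  set q := (r1 + r2) / (1 - gamma).
  have -> : q - q * (1 - (1 - lambda * (1 - gamma)) ^+ (N * E)) =
      (r1 + r2) * ((1 - gamma)^-1 * (a1 ^+ E) ^+ N).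
    by rewrite /q mulnC exprM -/a1; ring.
  apply: (@le_trans _ _ (`|r1 + r2| / expR 1 * B)).
    by rewrite ler_wpM2r // ge_min lexx.
  rewrite normrM -mulrA ler_wpM2l //; apply: le_trans (ler_norm _).
  have -> : (expR 1)^-1 * B = (1 - gamma)^-1 * (expR 1 * N%:R)^-1.
    by rewrite /B !invfM mulrCA.
  by rewrite ler_wpM2l // invr_ge0 ltW.
apply: le_trans (state_diff_norm _).
have := drift_ge gamma lambda E N gamma_gt0 gamma_lt1 l0 lg' E2 hN a1N.
rewrite -/a1 -/a2.
set S1 := geosum a1 E; set S2 := geosum a2 E.
set kappa := _ / _ => kB.
rewrite diffD qd (run_diff _ _ _ _ _ _ E0 K0 K_even _ _ kappa); last first.
  have a20 : 0 <= a2 by rewrite /a2 subr_ge0.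
  have a10 : 0 <= a1.
    apply: le_trans a20 _; rewrite /a1 /a2.
    have := mulr_gt0 l0 gamma_gt0; lra.
  have D0 : (1 - gamma) * S1 + (1 + gamma) * S2 != 0.
    by rewrite gt_eqF // addr_gt0 // mulr_gt0 ?geosum_gt0 // addr_gt0.
  rewrite -/a1 -/a2 -/S1 -/S2.
  (* These substitutions reduce the fixed-point equation to [(1 + kappa) * ((1 - gamma) * S1 + (1 +
     gamma) * S2) = S1 + S2]. *)
  have -> : a1 ^+ E = 1 - (1 - a1) * S1 by rewrite -geosum_sub1; ring.
  have -> : a2 ^+ E = 1 - (1 - a2) * S2 by rewrite -geosum_sub1; ring.
  by rewrite /kappa /a1 /a2; field.
rewrite -/a1 -/a2.
set A := ((_ + _) / 2) ^+ N in kB *.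
have -> : r1 - r2 - (r1 - r2) * (1 + kappa) * (1 - A) =
  (r1 - r2) * - (kappa - (1 + kappa) * A) by ring.
rewrite normrM normrN; apply: ler_pM => //.
- by rewrite ge_min lexx orbT.
- exact: le_trans (ler_norm _).
Qed.
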